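(* Let $m$ be a positive integer, let $X$ be a countable subset of $\mathbb{C}^m$ and let $\mathbb{K}$ be a dense subset of $\mathbb{C}$. For each $u\in X$, fix a dense subset $E_u\subseteq\mathbb{C}$, and suppose that if $(0,\ldots,0)\in X$, then $E_{(0,\ldots,0)}\cap\mathbb{K}\neq\emptyset$. Then there exist uncountably many transcendental entire functions $f:\mathbb{C}^m\to\mathbb{C}$ with $f\in\mathbb{K}[[z_1,\ldots,z_m]]$ such that $f(u)\in E_u$ for all $u\in X$.
   Context: An entire function is an analytic function $f:\mathbb{C}^m\to\mathbb{C}$. It is algebraic (over $\mathbb{C}(z_1,\ldots,z_m)$) if there is a nonzero polynomial $P\in\mathbb{C}[z_1,\ldots,z_m,z_{m+1}]$ with $P(z_1,\ldots,z_m,f(z_1,\ldots,z_m))=0$ for all $(z_1,\ldots,z_m)\in\mathbb{C}^m$; it is transcendental if it is not algebraic. For a subset $\mathbb{K}\subseteq\mathbb{C}$ (not assumed to be a ring or field) and an entire function $f$, one writes $f\in\mathbb{K}[[z_1,\ldots,z_m]]$ if $f(z_1,\ldots,z_m)=\sum_{(k_1,\ldots,k_m)\in\mathbb{Z}_{\geq 0}^m}c_{k_1,\ldots,k_m}z_1^{k_1}\cdots z_m^{k_m}$ for all $(z_1,\ldots,z_m)\in\mathbb{C}^m$, with $c_{k_1,\ldots,k_m}\in\mathbb{K}$ for all $(k_1,\ldots,k_m)\in\mathbb{Z}_{\geq 0}^m$. *)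

(* Defs.v *)
From HB Require Import structures.
From mathcomp Require Import all_boot all_order all_algebra.
From mathcomp Require Import finmap complex.
From mathcomp Require Import boolp classical_sets functions cardinality.
From mathcomp Require Import reals topology normedtype summability.
From mathcomp Require mpoly.

(* The notations of mpoly and of MathComp-Analysis are incompatible. *)
Import -(notations) mpoly.
Import numFieldNormedType.Exports.
Import Order.TTheory GRing.Theory Num.Theory.

Set Implicit Arguments.
Unset Strict Implicit.
Unset Printing Implicit Defensive.

Local Open Scope classical_set_scope.
Local Open Scope ring_scope.

(* The topology of MathComp-Analysis is only found on complex numbers through
   an abstract number field structure, whence this definition. *)
Definition CC (R : realType) : numClosedFieldType := complex R.

Section Entire.
Variables (R : realType) (m : nat).
Implicit Types (f : 'rV[CC R]_m -> CC R) (c : multinom m -> CC R).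

(* Unconditional convergence, i.e. convergence of the net of the finite partial
   sums; over the complex numbers this is the same as absolute convergence. *)
Definition power_series_sum c (z : 'rV[CC R]_m) (s : CC R) : Prop :=
  partial_sum (fun k : multinom m => c k * \prod_(i < m) z 0 i ^+ k i)
    @ totally --> s.

Definition entire f : Prop :=
  forall a : 'rV[CC R]_m, exists c,
    \forall z \near a, power_series_sum c (z - a) (f z).

(* The last variable of P is the one evaluated at f z. *)
Definition algebraic f : Prop :=
  exists2 P : mpoly m.+1 (CC R), P != 0 &
    forall z : 'rV[CC R]_m,
      meval (fun i : 'I_m.+1 =>
               if unlift ord_max i is Some j then z 0 j else f z) P = 0.

Definition transcendental f : Prop := ~ algebraic f.

Definition power_series_over (K : set (CC R)) f : Prop :=
  exists2 c, forall k, K (c k) &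
    forall z : 'rV[CC R]_m, power_series_sum c z (f z).

End Entire.

(* Main.v *)
Require Import Defs.
From HB Require Import structures.
From mathcomp Require Import all_boot all_order all_algebra.
From mathcomp Require Import finmap complex.
From mathcomp Require Import boolp classical_sets functions cardinality.
From mathcomp Require Import reals topology normedtype summability.
From mathcomp Require Import ereal lebesgue_measure.
From mathcomp Require mpoly.
Import -(notations) mpoly.
Import numFieldNormedType.Exports.
Import Order.TTheory GRing.Theory Num.Theory.

Set Implicit Arguments.
Unset Strict Implicit.
Unset Printing Implicit Defensive.

Local Open Scope classical_set_scope.
Local Open Scope ring_scope.

(** The function is a sum [f = Q 0 + Q 1 + Q 2 + ...] of polynomials, where
    [Q 0] is a constant of [K], taken in [E 0] when the origin is in [X], and
    the others are chosen one after the other.  Let [w 0, w 1, ...] be a list of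
    nonzero points at which something is required of the value of [f].  Step [n]
    chooses [Q (n + 1)] so that
    - it only has monomials of degree above [n], so the coefficients of degree
      at most [n] obtained so far are final;
    - it vanishes at [w 0, ..., w (n - 1)], so the values there are final;
    - the coefficients of degree [n + 1] of the new sum are in [K], and the value
      at [w n] of the new sum is as required;
    - [pnorm n (Q (n + 1))], the sum of the absolute values of its terms on the
      polydisc of radius [n], is at most [2 ^- n.+1].
    The third item is compatible with the first two thanks to products of
    Lagrange factors: the polynomial [M * 'X^k], where [M 0 = 1] and [M] vanishes
    at the previous points, moves the coefficient of ['X^k] and no other one of
    degree at most [mdeg k] ([correct_coeffs]); and a multiple of [G * 'X_i ^ l],
    where [G] is the interpolating polynomial of [w n], moves the value at [w n]
    ([correct_value]).  Both kinds of corrections are small because [K] and the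
    sets of required values are dense.  At a nonzero point with a coordinate of
    absolute value at least [2 * n], the value can even be prescribed exactly,
    since [('X_i / w n i) ^ l] is as small as desired on the polydisc of radius
    [n].  The bound on [pnorm] makes the rearrangement of the double series of the
    terms of the [Q n] legitimate, at the origin and after recentring at any
    point, so that [f] is entire and its coefficients are the final ones
    ([interpolation]).

    Exact values at far away points give the rest.  For each [e], infinitely many
    points [(t, t ^ e, ..., t ^ (e ^ (m - 1)))] are given the value [t ^ (e ^ m)].
    A polynomial relation [P (z, f z) = 0] of degree less than [e] becomes there
    a univariate equation [p t = 0] whose exponents are the exponents of [P] read
    as digits in base [e]; having infinitely many roots, [p] is [0], and so is
    [P] because digits are unique ([transcendental_of_values]).  Finally, given an
    enumeration [g 0, g 1, ...] of functions, the value [g j x + 1] is prescribed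
    at one more point [x] for each [j], so no enumeration exhausts the functions
    obtained.  The points are kept out of [X] by choosing [t] outside of the
    countable set of the first coordinates of [X]. *)

(** * The coefficient norm of a polynomial on a polydisc *)

Section PolynomialNorm.
Variables (F : numFieldType) (m : nat).
Implicit Types (p q : mpoly m F) (k : multinom m) (r : F) (a : 'rV[F]_m).

(** The sum of the absolute values of the terms of [p] on the polydisc of radius
    [r].  Its very definition bounds each coefficient and each partial sum of
    terms, for which the supremum norm would require Cauchy's formula. *)
Definition pnorm r p : F := \sum_(k <- msupp p) `|mcoeff k p| * r ^+ mdeg k.

(** Sums over different supports are compared by extending them to a common
    list of monomials. *)
Lemma pnorm_widen r p (s : seq (multinom m)) :
  uniq s -> {subset msupp p <= s} ->
  pnorm r p = \sum_(k <- s) `|mcoeff k p| * r ^+ mdeg k.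
Proof.
move=> us sub; rewrite (bigID (mem (msupp p))) /= [X in _ + X]big1 ?addr0.
  rewrite -big_filter; apply: perm_big; apply: uniq_perm => //.
    exact: filter_uniq.
  by move=> k; rewrite mem_filter /=; case: (boolP (k \in msupp p)) => // /sub.
by move=> k /memN_msupp_eq0 ->; rewrite normr0 mul0r.
Qed.

Lemma pnorm_ge0 r p : 0 <= r -> 0 <= pnorm r p.
Proof. by move=> r0; apply: sumr_ge0 => k _; rewrite mulr_ge0 ?exprn_ge0. Qed.

Lemma le_pnorm r r' p : 0 <= r -> r <= r' -> pnorm r p <= pnorm r' p.
Proof.
move=> r0 rr'; apply: ler_sum => k _; apply: ler_wpM2l => //.
by apply: lerXn2r => //; rewrite nnegrE // (le_trans r0).
Qed.

Lemma pnorm_coeff r p k : 0 <= r -> `|mcoeff k p| * r ^+ mdeg k <= pnorm r p.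
Proof.
move=> r0; case: (boolP (k \in msupp p)) => [kp|/memN_msupp_eq0 ->]; last first.
  by rewrite normr0 mul0r pnorm_ge0.
rewrite /pnorm (bigD1_seq k) ?msupp_uniq //= lerDl sumr_ge0 // => i _.
by rewrite mulr_ge0 ?exprn_ge0.
Qed.

Lemma pnormD r p q : 0 <= r -> pnorm r (p + q) <= pnorm r p + pnorm r q.
Proof.
move=> r0; pose s := undup (msupp p ++ msupp q).
have us : uniq s by exact: undup_uniq.
rewrite (@pnorm_widen r (p + q) s) //; last first.
  by move=> k /msuppD_le; rewrite mem_undup.
rewrite (@pnorm_widen r p s) //; last first.
  by move=> k kp; rewrite mem_undup mem_cat kp.
rewrite (@pnorm_widen r q s) //; last first.
  by move=> k kp; rewrite mem_undup mem_cat kp orbT.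
rewrite -big_split /=; apply: ler_sum => k _.
by rewrite mcoeffD -mulrDl ler_wpM2r ?exprn_ge0 ?ler_normD.
Qed.

Lemma pnorm0 r : pnorm r 0 = 0.
Proof. by rewrite /pnorm big1 // => k _; rewrite mcoeff0 normr0 mul0r. Qed.

Lemma pnorm_sum r I (s : seq I) (P : pred I) (p_ : I -> mpoly m F) : 0 <= r ->
  pnorm r (\sum_(i <- s | P i) p_ i) <= \sum_(i <- s | P i) pnorm r (p_ i).
Proof.
move=> r0; elim/big_rec2: _ => [|i y x _ le_xy]; first by rewrite pnorm0.
by rewrite (le_trans (pnormD _ _ r0)) // lerD2l.
Qed.

Lemma pnormZX r c k : pnorm r (c *: mpolyX F k) = `|c| * r ^+ mdeg k.
Proof.
rewrite (@pnorm_widen r _ [:: k]) //; last first.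
  by move=> i /msuppZ_le; rewrite msuppX.
by rewrite big_seq1 mcoeffZ mcoeffX eqxx mulr1.
Qed.

Lemma pnormZ r c p : pnorm r (c *: p) = `|c| * pnorm r p.
Proof.
rewrite (@pnorm_widen r _ (msupp p)) ?msupp_uniq //; last exact: msuppZ_le.
rewrite mulr_sumr; apply: eq_bigr => k _.
by rewrite mcoeffZ normrM mulrA.
Qed.

Lemma pnormX r k : pnorm r (mpolyX F k) = r ^+ mdeg k.
Proof. by rewrite -[mpolyX _ _]scale1r pnormZX normr1 mul1r. Qed.

Lemma pnorm1 r : pnorm r 1 = 1.
Proof. by rewrite -(mpolyX0 m F) pnormX mdeg0 expr0. Qed.

Lemma pnormM r p q : 0 <= r -> pnorm r (p * q) <= pnorm r p * pnorm r q.
Proof.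
move=> r0; rewrite {1}(mpolyE p) {1}(mpolyE q) big_distrl /=.
apply: (le_trans (pnorm_sum _ _ _ r0)).
rewrite /pnorm big_distrl /=; apply: ler_sum => k _.
rewrite big_distrr /=; apply: (le_trans (pnorm_sum _ _ _ r0)).
rewrite big_distrr /=; apply: ler_sum => l _.
rewrite -scalerAl -scalerAr scalerA -mpolyXD pnormZX mdegD exprD normrM.
by rewrite mulrACA.
Qed.

Lemma pnorm_prod r I (s : seq I) (p_ : I -> mpoly m F) : 0 <= r ->
  pnorm r (\prod_(i <- s) p_ i) <= \prod_(i <- s) pnorm r (p_ i).
Proof.
move=> r0; elim: s => [|i s IH]; first by rewrite !big_nil pnorm1.
by rewrite !big_cons (le_trans (pnormM _ _ r0)) // ler_wpM2l // pnorm_ge0.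
Qed.

Lemma pnorm_exp r p n : 0 <= r -> pnorm r (p ^+ n) <= pnorm r p ^+ n.
Proof.
move=> r0; elim: n => [|n IH]; first by rewrite !expr0 pnorm1.
by rewrite !exprS (le_trans (pnormM _ _ r0)) // ler_wpM2l // pnorm_ge0.
Qed.

(** Not only the value of [p] but every partial sum of its terms is bounded by the
    norm: this is what unconditional convergence asks for. *)
Lemma partial_eval_le r p (z : 'I_m -> F) (s : seq (multinom m)) :
  uniq s -> (forall i, `|z i| <= r) ->
  `|\sum_(k <- s) mcoeff k p * \prod_(i < m) z i ^+ k i| <= pnorm r p.
Proof.
move=> us zr.
have mono k : `|\prod_(i < m) z i ^+ k i| <= r ^+ mdeg k.
  rewrite normr_prod mdegE -prodrXr; apply: ler_prod => i _.
  by rewrite normrX exprn_ge0 //= lerXn2r ?nnegrE // (le_trans _ (zr i)).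
pose t := undup (s ++ msupp p).
rewrite (@pnorm_widen r p t) ?undup_uniq //; last first.
  by move=> k kp; rewrite mem_undup mem_cat kp orbT.
rewrite (le_trans (ler_norm_sum _ _ _)) //.
have -> : \sum_(k <- t) `|mcoeff k p| * r ^+ mdeg k =
  \sum_(k <- s) `|mcoeff k p| * r ^+ mdeg k +
  \sum_(k <- t | k \notin s) `|mcoeff k p| * r ^+ mdeg k.
  rewrite (bigID (mem s)) /=; congr (_ + _); rewrite -big_filter.
  apply: perm_big; apply: uniq_perm => //; first exact/filter_uniq/undup_uniq.
  by move=> k; rewrite mem_filter mem_undup mem_cat; case: (k \in s).
rewrite -[leLHS]addr0; apply: lerD.
  by apply: ler_sum => k _; rewrite normrM ler_wpM2l.
apply: sumr_ge0 => k _; rewrite mulr_ge0 //.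
apply: le_trans (mono k); exact: normr_ge0.
Qed.

Lemma meval_le r p (z : 'I_m -> F) :
  (forall i, `|z i| <= r) -> `|meval z p| <= pnorm r p.
Proof. by move=> zr; rewrite mevalE partial_eval_le ?msupp_uniq. Qed.

Definition recentre a p : mpoly m F :=
  comp_mpoly [tuple mpolyX F (mnm1 i) + mpolyC m (a 0 i) | i < m] p.

Lemma meval_recentre a p (z : 'I_m -> F) :
  meval z (recentre a p) = meval (fun i => z i + a 0 i) p.
Proof.
rewrite comp_mpoly_meval; apply: meval_eq => i.
by rewrite tnth_mktuple mevalD mevalXU mevalC.
Qed.

(** Each factor [X_i + a_i] of a monomial has norm at most [r + b], which is also
    the norm of [X_i] on the larger polydisc. *)
Lemma pnorm_recentre r a p (b : F) : 0 <= r -> (forall i, `|a 0 i| <= b) ->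
  pnorm r (recentre a p) <= pnorm (r + b) p.
Proof.
move=> r0 ab; rewrite /recentre comp_mpolyEX.
apply: (le_trans (pnorm_sum _ _ _ r0)); apply: ler_sum => k _.
rewrite pnormZ; apply: ler_wpM2l => //.
rewrite comp_mpolyX mdegE -prodrXr.
apply: (le_trans (pnorm_prod _ _ r0)); apply: ler_prod => i _.
rewrite pnorm_ge0 //= (le_trans (pnorm_exp _ _ r0)) //.
rewrite tnth_mktuple.
have h : pnorm r (mpolyX F (mnm1 i) + mpolyC m (a 0 i)) <= r + b.
  rewrite (le_trans (pnormD _ _ r0)) // pnormX mdeg1 expr1 lerD2l.
  rewrite -alg_mpolyC pnormZ pnorm1 mulr1; exact: ab.
by rewrite lerXn2r // nnegrE ?(le_trans _ h) ?pnorm_ge0.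
Qed.

End PolynomialNorm.

(** * Convergence of complex series with a geometric bound *)

Section ComplexSeries.
Variable R : realType.

Lemma ge0_realE (x : CC R) : 0 <= x -> x = (complex.Re x)%:C%C.
Proof. by case: x => a b; rewrite lecE /= => /andP[/eqP -> _]. Qed.

Lemma ge0_le_nat (x : CC R) : 0 <= x -> exists n : nat, x <= n%:R.
Proof.
move=> x0; have [n xn] : exists n : nat, complex.Re x <= n%:R.
  exists (Num.trunc (complex.Re x)).+1; exact/ltW/truncnS_gt.
by exists n; rewrite (ge0_realE x0) -(rmorph_nat (real_complex R)) lecR.
Qed.

Lemma expV2_lt (e : CC R) : 0 < e -> exists n : nat, 2 ^- n < e.
Proof.
move=> e0; have [n en] := @ge0_le_nat e^-1 (ltW (etrans (invr_gt0 _) e0)).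
exists n; rewrite -[e]invrK ltf_pV2 ?posrE ?invr_gt0 ?exprn_gt0 //.
by rewrite (le_lt_trans en) // -natrX ltr_nat ltn_expl.
Qed.

Lemma sum_expV2 (F : numFieldType) (N M : nat) : (N <= M)%N ->
  \sum_(N <= n < M) 2 ^- n <= 2 * 2 ^- N :> F.
Proof.
move=> NM; have h n : 2 ^- n = - (2 * 2 ^- n.+1) - - (2 * 2 ^- n) :> F.
  rewrite exprS invfM mulVKf ?pnatr_eq0 // opprK addrC mulr_natl mulr2n.
  by rewrite addrK.
rewrite (eq_bigr _ (fun n _ => h n)).
rewrite (telescope_sumr (fun n => - (2 * 2 ^- n))) //.
by rewrite opprK addrC gerDl oppr_le0 mulr_ge0 // invr_ge0 exprn_ge0.
Qed.

(** The intervals of centre the [M]-th partial sum and of radius [2 * 2 ^- M] have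
    pairwise common points, so the supremum of their lower ends is in all of
    them. *)
Lemma real_geometric_cvg (a : nat -> R) (N : nat) :
  (forall n, (N <= n)%N -> `|a n| <= 2 ^- n) ->
  exists s, forall M, (N <= M)%N -> `|s - \sum_(n < M) a n| <= 2 * 2 ^- M.
Proof.
move=> aN; pose S M := \sum_(n < M) a n.
have SS M L : (N <= M)%N -> (M <= L)%N -> `|S L - S M| <= 2 * 2 ^- M.
  move=> NM ML; rewrite /S -!(big_mkord xpredT) (big_cat_nat _ ML) //=.
  rewrite addrAC subrr add0r (le_trans (ler_norm_sum _ _ _)) //.
  apply: le_trans (sum_expV2 _ ML); rewrite !big_nat; apply: ler_sum => n.
  by move=> /andP[Mn _]; rewrite aN // (leq_trans NM).
pose A := [set x | exists2 M, (N <= M)%N & x = S M - 2 * 2 ^- M].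
have lo_le_up M L : (N <= M)%N -> (N <= L)%N ->
    S L - 2 * 2 ^- L <= S M + 2 * 2 ^- M.
  move=> NM NL; have [ML|/ltnW LM] := leqP M L.
    have := SS _ _ NM ML; rewrite ler_norml => /andP[_].
    rewrite lerBlDl => h; rewrite lerBlDr (le_trans h) // lerDl.
    by rewrite mulr_ge0 // invr_ge0 exprn_ge0.
  have := SS _ _ NL LM; rewrite ler_norml => /andP[+ _].
  rewrite lerBrDr addrC => h; rewrite (le_trans h) // lerDl.
  by rewrite mulr_ge0 // invr_ge0 exprn_ge0.
have A0 : A !=set0 by exists (S N - 2 * 2 ^- N), N.
exists (sup A) => M NM.
have leA : sup A <= S M + 2 * 2 ^- M.
  by apply: ge_sup => // _ [L NL ->]; exact: lo_le_up.
have geA : S M - 2 * 2 ^- M <= sup A.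
  apply: ub_le_sup; last by exists M.
  by exists (S N + 2 * 2 ^- N) => _ [L NL ->]; exact: lo_le_up.
by rewrite ler_distl -/(S M) geA leA.
Qed.

Lemma normc_le_Re_Im (x : CC R) :
  `|x| <= (`|complex.Re x| + `|complex.Im x|)%:C%C.
Proof.
rewrite {1}(complexE x) (le_trans (ler_normD _ _)) // rmorphD /= normrM.
have -> : `|'i%C : CC R| = 1.
  by rewrite normc_def /= expr0n /= expr1n add0r sqrtr1.
by rewrite mul1r !normc_def /= expr0n /= !addr0 !sqrtr_sqr.
Qed.

Lemma normc_ge_Im (x : CC R) : (`|complex.Im x|)%:C%C <= `|x|.
Proof.
have := normc_ge_Re (x * 'i%C); rewrite ReiNIm normrN normrM.
have -> : `|'i%C : CC R| = 1.
  by rewrite normc_def /= expr0n /= expr1n add0r sqrtr1.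
by rewrite mulr1.
Qed.

(** The real and imaginary parts are summed separately; this stands for the
    completeness of the complex numbers. *)
Lemma geometric_cvg (a : nat -> CC R) :
  (exists N, forall n, (N <= n)%N -> `|a n| <= 2 ^- n) ->
  exists s : CC R, (fun M => \sum_(n < M) a n) @ \oo --> s.
Proof.
move=> [N aN].
have rV n : 2 ^- n = (2 ^- n : R)%:C%C :> CC R.
  by rewrite fmorphV rmorphXn rmorph_nat.
have [|sR hR] := @real_geometric_cvg (fun n => complex.Re (a n)) N.
  by move=> n /aN; rewrite rV -lecR; apply: le_trans; exact: normc_ge_Re.
have [|sI hI] := @real_geometric_cvg (fun n => complex.Im (a n)) N.
  move=> n /aN; rewrite rV -lecR; apply: le_trans.
  by exact: normc_ge_Im.
exists (sR +i* sI)%C; apply/cvgrPdist_lt => e e0.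
have [K Ke] := expV2_lt (divr_gt0 e0 (ltr0Sn _ 3)).
exists (maxn N K) => // M /=; rewrite geq_max => /andP[NM KM].
rewrite (le_lt_trans (normc_le_Re_Im _)) //.
have Re_sum : complex.Re (\sum_(n < M) a n) = \sum_(n < M) complex.Re (a n).
  by apply: (big_morph (@complex.Re R)) => // -[? ?] [? ?].
have Im_sum : complex.Im (\sum_(n < M) a n) = \sum_(n < M) complex.Im (a n).
  by apply: (big_morph (@complex.Im R)) => // -[? ?] [? ?].
have ReB (x y : CC R) : complex.Re (x - y) = complex.Re x - complex.Re y.
  by case: x y => ? ? [? ?].
have ImB (x y : CC R) : complex.Im (x - y) = complex.Im x - complex.Im y.
  by case: x y => ? ? [? ?].
rewrite ReB ImB Re_sum Im_sum /=.
apply: le_lt_trans (_ : 4 * 2 ^- M < e); last first.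
  rewrite mulrC -ltr_pdivlMr ?ltr0n //; apply: le_lt_trans Ke.
  by rewrite lef_pV2 ?posrE ?exprn_gt0 // ler_weXn2l // ler1n.
have -> : 4 * 2 ^- M = (2 * 2 ^- M + 2 * 2 ^- M : R)%:C%C.
  by rewrite -mulrDl rmorphM rV -natrD rmorph_nat.
by rewrite lecR lerD ?hR ?hI.
Qed.

End ComplexSeries.

(** * Entire functions as sums of rapidly decreasing polynomials *)

Section FastSeries.
Variables (R : realType) (m : nat).
Local Notation C := (CC R).
Implicit Types (Q : nat -> mpoly m C).

(** The [n]-th bound is only required from some rank on, which depends on the
    radius: it is enough to bound [Q n] on the polydisc of radius [n]. *)
Definition fast Q := forall r : nat, exists N, forall n, (N <= n)%N ->
  pnorm r%:R (Q n) <= 2 ^- n.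

Lemma bounded_by_nat (z : 'rV[C]_m) : exists r : nat, forall i, `|z 0 i| <= r%:R.
Proof.
have [|r hr] := @ge0_le_nat R (\sum_i `|z 0 i|); first exact: sumr_ge0.
exists r => i; apply: le_trans hr; rewrite (bigD1 i) //= lerDl.
exact: sumr_ge0.
Qed.

(** Rearrangement of the double series of the terms of the [Q n].  A finite set
    [S] of monomials that contains those of [Q 0, ..., Q (N - 1)] treats these
    exactly, and for [n >= N] both [Q n z] and its part in [S] are bounded by
    [2 ^- n]; so the error is at most [4 * 2 ^- N]. *)
Lemma fast_power_series Q (c : multinom m -> C) (z : 'rV[C]_m) (s : C) :
  fast Q ->
  (forall k, (fun M => \sum_(n < M) mcoeff k (Q n)) @ \oo --> c k) ->
  (fun M => \sum_(n < M) meval (z 0) (Q n)) @ \oo --> s ->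
  power_series_sum c z s.
Proof.
move=> fastQ Qc Qs; have [r zr] := bounded_by_nat z.
have totallyF : Filter (@totally (multinom m)) by exact: totally_filter.
apply/cvgrPdist_lt => e e0.
have e20 : 0 < e / 2 by rewrite divr_gt0.
have [N1 QN1] := fastQ r.
have [N2 eN2] := @expV2_lt R _ (divr_gt0 e20 (ltr0Sn _ 3)).
pose N := maxn N1 N2.
exists [fset k in flatten [seq msupp (Q n) | n <- iota 0 N]]%fset => // S /= QS.
have -> : partial_sum (fun k => c k * \prod_(i < m) z 0 i ^+ k i) S =
    \sum_(k <- enum_fset S) c k * \prod_(i < m) z 0 i ^+ k i.
  by rewrite /partial_sum big_seq_fsetE.
pose u M := \sum_(n < M) meval (z 0) (Q n) -
  \sum_(k <- enum_fset S)
    (\sum_(n < M) mcoeff k (Q n)) * \prod_(i < m) z 0 i ^+ k i.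
have u_lim : u M @[M --> \oo] -->
    s - \sum_(k <- enum_fset S) c k * \prod_(i < m) z 0 i ^+ k i.
  apply: cvgB; first exact: Qs.
  elim: (enum_fset S) => [|k t IH].
    by under eq_fun do rewrite big_nil; rewrite big_nil; exact: cvg_cst.
  under eq_fun do rewrite big_cons; rewrite big_cons.
  by apply: cvgD; [apply: cvgMl; exact: Qc|exact: IH].
have u_small M : `|u M| <= 4 * 2 ^- N.
  (* The contribution of Q n to the error u M. *)
  pose d n := meval (z 0) (Q n) - \sum_(k <- enum_fset S)
    mcoeff k (Q n) * \prod_(i < m) z 0 i ^+ k i.
  have uE : u M = \sum_(0 <= n < M) d n.
    rewrite /u big_mkord sumrB; congr (_ - _).
    by rewrite exchange_big /=; apply: eq_bigr => k _; rewrite mulr_suml.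
  have d0 n : (n < N)%N -> d n = 0.
    move=> nN; apply/eqP; rewrite subr_eq0; apply/eqP; rewrite mevalE.
    rewrite [RHS](bigID (mem (msupp (Q n)))) /= [X in _ + X]big1 ?addr0.
      rewrite -[RHS]big_filter; apply: perm_big; apply: uniq_perm.
      - exact: msupp_uniq.
      - exact/filter_uniq/fset_uniq.
      move=> k; rewrite mem_filter /=; case: (boolP (_ \in msupp _)) => // kQ.
      apply/esym; apply: (fsubsetP QS); rewrite !inE /=.
      by apply/flatten_mapP; exists n; rewrite // mem_iota.
    by move=> k /memN_msupp_eq0 ->; rewrite mul0r.
  have dN n : (N <= n)%N -> `|d n| <= 2 * 2 ^- n.
    move=> Nn; have /QN1 Qn : (N1 <= n)%N by rewrite (leq_trans _ Nn) ?leq_maxl.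
    rewrite (le_trans (ler_normB _ _)) // mulr_natl mulr2n lerD //.
      by apply: le_trans Qn; exact: meval_le.
    apply: le_trans Qn; apply: partial_eval_le => //; exact: fset_uniq.
  have sum0 L : (L <= N)%N -> \sum_(0 <= n < L) d n = 0.
    move=> LN; rewrite big_nat big1 // => n /andP[_ nL].
    by rewrite d0 // (leq_trans nL).
  have [MN|/ltnW NM] := leqP M N.
    by rewrite uE sum0 // normr0 mulr_ge0 // invr_ge0 exprn_ge0.
  rewrite uE (big_cat_nat _ NM) //= sum0 // add0r.
  rewrite (le_trans (ler_norm_sum _ _ _)) //.
  apply: (@le_trans _ _ (\sum_(N <= n < M) 2 * 2 ^- n)).
    by rewrite !big_nat; apply: ler_sum => n /andP[/dN].
  rewrite -mulr_sumr (le_trans (ler_wpM2l _ (sum_expV2 _ NM))) //.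
  by rewrite mulrA -natrM.
have /cvgrPdist_lt/(_ _ e20)[M _ /(_ M (leqnn M)) /= hM] := u_lim.
set l := s - _ in hM *.
rewrite -(subrK (u M) l) (le_lt_trans (ler_normD _ _)) // [ltRHS]splitr.
rewrite ltrD // (le_lt_trans (u_small M)) // mulrC -ltr_pdivlMr ?ltr0n //.
apply: le_lt_trans eN2.
by rewrite lef_pV2 ?posrE ?exprn_gt0 // ler_weXn2l ?ler1n // leq_maxr.
Qed.

Lemma fast_recentre Q (a : 'rV[C]_m) : fast Q -> fast (fun n => recentre a (Q n)).
Proof.
move=> fastQ r; have [b ab] := bounded_by_nat a.
have [N QN] := fastQ (r + b)%N; exists N => n /QN; apply: le_trans.
by rewrite natrD pnorm_recentre.
Qed.

(** On the polydisc of radius [1], the norm bounds every coefficient. *)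
Lemma fast_coeff_cvg Q k : fast Q ->
  exists c : C, (fun M => \sum_(n < M) mcoeff k (Q n)) @ \oo --> c.
Proof.
move=> /(_ 1)[N QN].
apply: (@geometric_cvg R (fun n => mcoeff k (Q n))); exists N => n /QN.
apply: le_trans; have := @pnorm_coeff _ _ 1 (Q n) k ler01.
by rewrite expr1n mulr1.
Qed.

Lemma fast_meval_cvg Q (z : 'rV[C]_m) : fast Q ->
  exists s : C, (fun M => \sum_(n < M) meval (z 0) (Q n)) @ \oo --> s.
Proof.
have [r zr] := bounded_by_nat z.
move=> /(_ r)[N QN].
apply: (@geometric_cvg R (fun n => meval (z 0) (Q n))); exists N => n /QN.
by apply: le_trans; exact: meval_le.
Qed.

(** Recentring at [a] keeps the family fast, so the rearrangement of the recentred
    polynomials is a power series expansion at [a]. *)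
Lemma fast_entire Q (f : 'rV[C]_m -> C) : fast Q ->
  (forall z : 'rV[C]_m,
    (fun M => \sum_(n < M) meval (z 0) (Q n)) @ \oo --> f z) ->
  entire f.
Proof.
move=> fastQ Qf a; have fastQa := fast_recentre a fastQ.
have [c Qc] := choice (fun k => fast_coeff_cvg k fastQa).
exists c; near=> z; apply: (fast_power_series fastQa Qc).
under eq_fun => M do under eq_bigr => n _ do rewrite meval_recentre.
have -> : (fun M => \sum_(n < M) meval (fun i => (z - a) 0 i + a 0 i) (Q n)) =
          (fun M => \sum_(n < M) meval (z 0) (Q n)); last exact: Qf.
apply/funext => M; apply: eq_bigr => n _; apply: meval_eq => i.
by rewrite !mxE subrK.
Unshelve. all: by end_near.
Qed.

End FastSeries.

(** * Small polynomials that correct coefficients and values *)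

Section SmallCorrections.
Variables (R : realType) (m : nat).
Local Notation C := (CC R).
Implicit Types (p q P : mpoly m C) (L : seq 'rV[C]_m) (w x : 'rV[C]_m).

Lemma dense_approx (A : set C) (a e : C) : dense A -> 0 < e ->
  exists2 y, A y & `|y - a| <= e.
Proof.
move=> dA e0; have [||y [ay Ay]] := dA (ball a e).
- by exists a; exact: ballxx.
- exact: ball_open.
by exists y => //; rewrite distrC ltW.
Qed.

Definition order_ge N p := forall k, (mdeg k < N)%N -> mcoeff k p = 0.

Lemma order_geD N p q : order_ge N p -> order_ge N q -> order_ge N (p + q).
Proof. by move=> hp hq k kN; rewrite mcoeffD hp // hq // addr0. Qed.

Lemma order_geZ N c p : order_ge N p -> order_ge N (c *: p).
Proof. by move=> hp k kN; rewrite mcoeffZ hp // mulr0. Qed.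

Lemma order_ge_leq N M p : (N <= M)%N -> order_ge M p -> order_ge N p.
Proof. by move=> NM hp k kN; rewrite hp // (leq_trans kN). Qed.

(** Multiplying by a monomial [a] shifts exponents by [a]: at or below the degree
    of [a], only the exponent [a] itself is reached. *)
Lemma mcoeffMX_lowest p a k : (mdeg k <= mdeg a)%N ->
  mcoeff k (p * mpolyX C a) = (k == a)%:R * mcoeff (@mnm0 m) p.
Proof.
move=> ka; have [->|neq] := eqVneq k a.
  by rewrite mul1r -{1}(addm0 a) mcoeffMX.
rewrite mul0r; apply: memN_msupp_eq0.
rewrite (perm_mem (msuppMX _ _)); apply/mapP => -[l _ kE].
move: ka neq; rewrite kE mdegD -[leqRHS]addn0 leq_add2l leqn0 mdeg_eq0.
by move=> /eqP ->; rewrite addm0 eqxx.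
Qed.

Lemma order_geMX p a : order_ge (mdeg a) (p * mpolyX C a).
Proof.
move=> k ka; rewrite mcoeffMX_lowest ?(ltnW ka) //.
by case: eqVneq ka => [->|]; rewrite ?ltnn // mul0r.
Qed.

Lemma mcoeff0_meval p : mcoeff (@mnm0 m) p = meval ((0 : 'rV[C]_m) 0) p.
Proof.
rewrite (mpolyE p) !raddf_sum /=; apply: eq_bigr => k _.
rewrite mcoeffZ mcoeffX mevalZ mevalX; congr (_ * _).
have [->|/eqP k0] := eqVneq k (@mnm0 m).
  by rewrite big1 // => i _; rewrite mnm0E expr0.
have [i ki] : exists i, k i != 0%N.
  apply/existsP; rewrite -negb_forall; apply/forallP => ki; apply: k0.
  by apply/mnmP => i; rewrite mnm0E; apply/eqP.
by rewrite (bigD1 i) //= mxE expr0n (negbTE ki) mul0r.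
Qed.

(** Lagrange interpolation: a factor for each [y] in [L], in a coordinate where
    [w] and [y] differ. *)
Lemma separating_poly w L : w \notin L -> exists2 G,
  meval (w 0) G = 1 & forall x, x \in L -> meval (x 0) G = 0.
Proof.
elim: L => [_|y L IH]; first by exists 1; rewrite ?meval1.
rewrite inE negb_or => /andP[wy /IH[G Gw GL]].
have [i wyi] : exists i, w 0 i != y 0 i.
  apply/existsP; rewrite -negb_forall; apply: contraNN wy => /forallP wy.
  by apply/eqP/rowP => i; apply/eqP.
exists ((w 0 i - y 0 i)^-1 *: (mpolyX C (mnm1 i) - mpolyC m (y 0 i)) * G).
  rewrite mevalM mevalZ mevalB mevalXU mevalC Gw mulr1 mulVf //.
  by rewrite subr_eq0.
move=> x; rewrite inE => /orP[/eqP ->|/GL xG]; last by rewrite mevalM xG mulr0.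
by rewrite mevalM mevalZ mevalB mevalXU mevalC subrr mulr0 mul0r.
Qed.

(** With [M] equal to [1] at the origin and to [0] on [L], the polynomial
    [M * 'X^k] changes the coefficient of ['X^k] and no other one of degree at most
    [mdeg k]; hence the coefficients of degree [N] can be moved into [K]
    independently, each by an amount as small as needed for the total. *)
Lemma correct_coeffs (K : set C) (r e : C) N P L : dense K -> 0 <= r -> 0 < e ->
  0 \notin L -> exists A,
  [/\ order_ge N A, forall k, mdeg k = N -> K (mcoeff k (P + A)),
      forall x, x \in L -> meval (x 0) A = 0 & pnorm r A <= e].
Proof.
move=> dK r0 e0 /separating_poly[M M0 ML].
pose S := \sum_(k : bmultinom m N.+1 | mdeg k == N) pnorm r (M * mpolyX C k).
have S0 : 0 <= S by apply: sumr_ge0 => k _; exact: pnorm_ge0.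
have S1 : 0 < 1 + S by rewrite ltr_wpDr.
have /choice[y yP] k : exists y, K y /\ `|y - mcoeff k P| <= e / (1 + S).
  by have [y] := dense_approx (mcoeff k P) dK (divr_gt0 e0 S1); exists y.
exists (\sum_(k : bmultinom m N.+1 | mdeg k == N)
  (y k - mcoeff k P) *: (M * mpolyX C k)); split.
- move=> k kN; rewrite raddf_sum /= big1 // => l /eqP lN.
  by rewrite mcoeffZ order_geMX ?mulr0 // lN.
- move=> k kN; rewrite mcoeffD raddf_sum /=.
  have kS : (mdeg k < N.+1)%N by rewrite kN.
  rewrite (bigD1 (BMultinom kS)) /= ?kN // big1 => [|l /andP[/eqP lN lk]].
    rewrite mcoeffZ mcoeffMX_lowest // eqxx mul1r mcoeff0_meval M0 mulr1.
    by rewrite addr0 addrC subrK; case: (yP k).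
  rewrite mcoeffZ mcoeffMX_lowest ?kN ?lN //.
  case: eqVneq => [kl|]; last by rewrite mul0r mulr0.
  by case/eqP: lk; apply/val_inj.
- move=> x xL; rewrite raddf_sum /= big1 // => l _.
  by rewrite mevalZ mevalM ML // mul0r mulr0.
apply: (le_trans (pnorm_sum _ _ _ r0)).
apply: (@le_trans _ _ (e / (1 + S) * S)).
  rewrite mulr_sumr; apply: ler_sum => k _; rewrite pnormZ ler_wpM2r //.
    exact: pnorm_ge0.
  by case: (yP k).
by rewrite mulrAC ler_pdivrMr // ler_wpM2l ?(ltW e0) // lerDr.
Qed.

(** The two reasons for which a polynomial that is small on the polydisc of radius
    [n] can bring the value at [w] into [D]: the move may be small, or [w] is far
    enough from the polydisc for the move to be arbitrary. *)
Definition reachable (n : nat) (D : set C) w :=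
  dense D \/ D !=set0 /\ exists2 i, w 0 i != 0 & 2 * n%:R <= `|w 0 i|.

(** The polynomial [H i l = G * ('X_i / w_i) ^ l] is [1] at [w] and vanishes on
    [L].  Near the target, [l := N] and a small multiple will do; at a far point,
    a high power [l] makes it small, for [n / |w_i| <= 1 / 2]. *)
Lemma correct_value (D : set C) (n N : nat) (e : C) P L w : 0 < e -> w != 0 ->
  w \notin L -> reachable n D w -> exists B,
  [/\ order_ge N B, D (meval (w 0) (P + B)),
      forall x, x \in L -> meval (x 0) B = 0 & pnorm n%:R B <= e].
Proof.
move=> e0 w0 /separating_poly[G Gw GL] far.
pose H i l := (w 0 i ^- l) *: (G * mpolyX C (mnm_muln (mnm1 i) l)).
have Hw i l : w 0 i != 0 -> meval (w 0) (H i l) = 1.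
  move=> wi; rewrite mevalZ mevalM Gw mul1r -mpolyXn rmorphXn /= mevalXU.
  by rewrite mulVf // expf_neq0.
have HL i l x : x \in L -> meval (x 0) (H i l) = 0.
  by move=> xL; rewrite mevalZ mevalM GL // mul0r mulr0.
have Hord i l : order_ge l (H i l).
  apply: order_geZ; rewrite -{1}[l]mul1n -(mdeg1 i) -mdegMn.
  exact: order_geMX.
suff [i [l [d [wi Nl Dd small]]]] : exists i l d, [/\ w 0 i != 0, (N <= l)%N,
    D d & `|d - meval (w 0) P| * pnorm n%:R (H i l) <= e].
  exists ((d - meval (w 0) P) *: H i l); split.
  - exact: order_ge_leq Nl (order_geZ _ (Hord i l)).
  - by rewrite mevalD mevalZ Hw // mulr1 addrC subrK.
  - by move=> x xL; rewrite mevalZ HL ?mulr0.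
  - by rewrite pnormZ.
case: far => [dD|[[d Dd] [i wi big]]].
  have [i wi] : exists i, w 0 i != 0.
    apply/existsP; rewrite -negb_forall; apply: contraNN w0 => /forallP w0.
    by apply/eqP/rowP => i; rewrite mxE; apply/eqP.
  have H0 : 0 <= pnorm n%:R (H i N) by exact: pnorm_ge0.
  have H1 : 0 < 1 + pnorm n%:R (H i N) by rewrite ltr_wpDr.
  have [d Dd dw] := dense_approx (meval (w 0) P) dD (divr_gt0 e0 H1).
  exists i, N, d; split => //; apply: le_trans (ler_wpM2r H0 dw) _.
  by rewrite mulrAC ler_pdivrMr // ler_wpM2l ?(ltW e0) // lerDr.
pose c := `|d - meval (w 0) P| * pnorm n%:R G.
have c0 : 0 <= c by rewrite mulr_ge0 // pnorm_ge0.
have c1 : 0 < 1 + c by rewrite ltr_wpDr.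
have [l el] := expV2_lt (divr_gt0 e0 c1).
exists i, (maxn N l), d; split => //; first exact: leq_maxl.
set t := maxn N l.
have Ht : pnorm n%:R (H i t) <= 2 ^- t * pnorm n%:R G.
  rewrite pnormZ mulrC normrV ?unitfE ?expf_neq0 // normrX.
  rewrite ler_pdivrMr ?exprn_gt0 ?normr_gt0 //.
  apply: (le_trans (pnormM _ _ (ler0n _ _))); rewrite pnormX mdegMn mdeg1 mul1n.
  rewrite [leRHS]mulrAC [leRHS]mulrC ler_wpM2l ?pnorm_ge0 // [leRHS]mulrC.
  rewrite ler_pdivlMr ?exprn_gt0 // -exprMn lerXn2r ?nnegrE ?mulr_ge0 //.
  by rewrite mulrC.
apply: (le_trans (ler_wpM2l (normr_ge0 _) Ht)); rewrite mulrCA -/c.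
apply: (@le_trans _ _ (e / (1 + c) * c)).
  rewrite ler_wpM2r // (le_trans _ (ltW el)) //.
  by rewrite lef_pV2 ?posrE ?exprn_gt0 // ler_weXn2l ?ler1n // leq_maxr.
by rewrite mulrAC ler_pdivrMr // ler_wpM2l ?(ltW e0) // lerDr.
Qed.

End SmallCorrections.

(** * Interpolation by entire functions with restricted coefficients *)

Section Interpolation.
Variables (R : realType) (m : nat).
Local Notation C := (CC R).
Variables (K : set C) (w : nat -> 'rV[C]_m) (D : 'rV[C]_m -> set C) (c0 : C).
Hypotheses (dK : dense K) (Kc0 : K c0) (w0 : forall n, w n != 0)
  (wD : forall n, reachable n (D (w n)) (w n)).

(** The correction of the value comes second and has order at least [n.+2], so that
    it leaves the corrected coefficients unchanged.  When [w n] already occurred,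
    its value must be kept instead of corrected. *)
Lemma correction_step n (P : mpoly m C) : exists Q,
  [/\ order_ge n.+1 Q, forall k, mdeg k = n.+1 -> K (mcoeff k (P + Q)),
      forall i, (i < n)%N -> meval (w i 0) Q = 0,
      w n \in mkseq w n \/ D (w n) (meval (w n 0) (P + Q))
    & pnorm n%:R Q <= 2 ^- n.+1].
Proof.
pose L := mkseq w n.
have L0 : 0 \notin L.
  by apply/mapP => -[i _ /esym/eqP]; rewrite (negbTE (w0 i)).
have iL i : (i < n)%N -> w i \in L.
  by move=> ni; apply/mapP; exists i; rewrite // mem_iota.
have e0 : 0 < 2 ^- n.+1 / 2 :> C by rewrite divr_gt0 // invr_gt0 exprn_gt0.
have [A [Aord AK AL Asmall]] := correct_coeffs n.+1 P dK (ler0n _ n) e0 L0.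
have [wL|wL] := boolP (w n \in L).
  exists A; split => //; last 2 first.
  - by left.
  - apply: le_trans Asmall _.
    by rewrite ler_pdivrMr // ler_peMr ?ler1n ?invr_ge0 ?exprn_ge0.
  by move=> i /iL; exact: AL.
have [B [Bord BD BL Bsmall]] :=
  correct_value n.+2 (P + A) e0 (w0 n) wL (wD n).
exists (A + B); split.
- by apply: order_geD => //; exact: order_ge_leq Bord.
- by move=> k kn; rewrite addrA mcoeffD Bord ?kn // addr0; exact: AK.
- by move=> i /iL iLn; rewrite mevalD AL // BL // addr0.
- by right; rewrite addrA.
by rewrite (le_trans (pnormD _ _ (ler0n _ _))) // [leRHS]splitr lerD.
Qed.

(** Iterating the corrections.  The points may repeat, so that the required values
    are a function [D] of the point and not of its index. *)
Theorem interpolation : exists f : 'rV[C]_m -> C,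
  [/\ entire f, power_series_over K f, f 0 = c0 & forall n, D (w n) (f (w n))].
Proof.
have /choice[q qP] (nP : nat * mpoly m C) := correction_step nP.1 nP.2.
(* P n is the sum of Q 0, ..., Q n; its coefficients of degree at most n and its
   values at w i, for i < n, are final. *)
pose P := fix P n := if n is i.+1 then P i + q (i, P i) else mpolyC m c0.
pose Q n := if n is i.+1 then q (i, P i) else mpolyC m c0.
have PS n : P n.+1 = P n + Q n.+1 by [].
have sumQ n : \sum_(i < n.+1) Q i = P n.
  elim: n => [|n IH]; first by rewrite big_ord1.
  by rewrite big_ord_recr /= IH.
have QP n := qP (n, P n).
have fastQ : fast Q.
  move=> r; exists r.+1 => -[//|n] rn; have [_ _ _ _] := QP n.
  by apply: le_trans; apply: le_pnorm; rewrite ?ler_nat.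
have coeff_stable k n : (mdeg k <= n)%N -> mcoeff k (P n) = mcoeff k (P (mdeg k)).
  elim: n => [|n IH]; first by rewrite leqn0 => /eqP ->.
  rewrite leq_eqVlt => /orP[/eqP ->//|kn].
  have [Qord _ _ _ _] := QP n.
  by rewrite PS mcoeffD IH // [mcoeff k (Q _)]Qord ?addr0.
have coeffK k : K (mcoeff k (P (mdeg k))).
  case E : (mdeg k) => [|n]; last first.
    by case: (QP n) => _ Qk _ _ _; exact: Qk.
  by move/eqP: E; rewrite mdeg_eq0 => /eqP ->; rewrite mcoeffC eqxx mulr1.
have value_stable i n : (i < n)%N -> meval (w i 0) (P n) = meval (w i 0) (P i.+1).
  elim: n => [//|n IH]; rewrite ltnS leq_eqVlt => /orP[/eqP ->//|ni].
  have [_ _ Qi _ _] := QP n.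
  by rewrite PS mevalD IH // [meval _ (Q _)]Qi ?addr0.
have value_ok i : D (w i) (meval (w i 0) (P i.+1)).
  elim/ltn_ind: i => i IH; case: (QP i) => _ _ _ [+|//] _.
  case/mapP => j; rewrite mem_iota add0n => /andP[_ ji] ->.
  by rewrite (@value_stable j i.+1) ?(ltn_trans ji) //; exact: IH.
have value0 n : meval ((0 : 'rV[C]_m) 0) (P n) = c0.
  rewrite -mcoeff0_meval coeff_stable mdeg0 //= mcoeffC eqxx mulr1 //.
have /choice[f Qf] (z : 'rV[C]_m) := fast_meval_cvg z fastQ.
have f_eq (z : 'rV[C]_m) N v : (forall n, (N <= n)%N -> meval (z 0) (P n) = v) ->
    f z = v.
  move=> Pv; apply: (cvg_unique (@norm_hausdorff _ C) (Qf z)).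
  apply: cvg_near_cst; exists N.+1 => // -[//|n] /= Nn.
  by rewrite -(Pv n Nn) -sumQ raddf_sum.
exists f; split.
- exact: fast_entire Qf.
- exists (fun k => mcoeff k (P (mdeg k))) => // z.
  apply: (fast_power_series fastQ _ (Qf z)) => k.
  apply: cvg_near_cst; exists (mdeg k).+1 => // -[//|n] /= kn.
  by rewrite -(coeff_stable k n kn) -sumQ raddf_sum.
- exact: (@f_eq _ 0).
move=> i; rewrite (@f_eq _ i.+1 _ (@value_stable i)); exact: value_ok.
Qed.

End Interpolation.

(** * Transcendence by Kronecker substitution *)

Lemma digits_inj (e n : nat) (a b : 'I_n -> nat) :
  (forall i, a i < e)%N -> (forall i, b i < e)%N ->
  (\sum_(i < n) a i * e ^ i = \sum_(i < n) b i * e ^ i)%N -> a =1 b.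
Proof.
elim: n a b => [|n IH] a b ae be; first by move=> _ [].
have shift (c : 'I_n.+1 -> nat) : (\sum_(i < n.+1) c i * e ^ i =
    (\sum_(i < n) c (lift ord0 i) * e ^ i) * e + c ord0)%N.
  rewrite big_ord_recl expn0 muln1 addnC; congr (_ + _)%N.
  by rewrite big_distrl /=; apply: eq_bigr => i _; rewrite -mulnA -expnSr.
rewrite !shift => eq_ab.
have ab0 : a ord0 = b ord0.
  have := congr1 (modn^~ e) eq_ab.
  by rewrite /= !modnMDl !modn_small.
have e0 : (0 < e)%N by apply: leq_trans (ae ord0).
move: eq_ab; rewrite ab0 => /addIn/eqP; rewrite eqn_pmul2r // => /eqP.
move=> /(IH _ _ (fun i => ae _) (fun i => be _)) abS i.
by have [j ->|->] := unliftP ord0 i.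
Qed.

(** Kronecker substitution: [X_i := t ^ (e ^ i)] turns [P] into a univariate
    polynomial.  Distinct monomials of [P] have distinct images, since their
    exponents are the digits in base [e] of the exponent of the image. *)
Lemma kronecker_eq0 (F : fieldType) (n e : nat) (P : mpoly n F) (s : nat -> F) :
  injective s -> (msize P <= e)%N ->
  (forall j, meval (fun i : 'I_n => s j ^+ (e ^ i)) P = 0) -> P = 0.
Proof.
move=> s_inj Pe Ps.
pose d (k : multinom n) := (\sum_(i < n) k i * e ^ i)%N.
pose p : {poly F} := \sum_(k <- msupp P) mcoeff k P *: 'X^(d k).
have p0 : p = 0.
  apply/eqP; apply: contraT => pn0.
  have := @max_poly_roots _ p (map s (iota 0 (size p))) pn0.
  rewrite size_map size_iota ltnn => -> //.
    apply/allP => _ /mapP[j _ ->]; apply/rootP; rewrite -(Ps j) mevalE.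
    rewrite horner_sum; apply: eq_bigr => k _.
    rewrite hornerZ hornerXn; congr (_ * _).
    rewrite /d -prodrXr; apply: eq_bigr => i _.
    by rewrite -exprM mulnC.
  by rewrite map_inj_uniq ?iota_uniq.
apply/mpolyP => k; rewrite mcoeff0.
case: (boolP (k \in msupp P)) => [kP|/memN_msupp_eq0 //].
have := congr1 (fun q : {poly F} => q`_(d k)) p0; rewrite coef0 coef_sum.
have small l : l \in msupp P -> forall i, (l i < e)%N.
  move=> lP i; apply: leq_trans Pe; apply: leq_ltn_trans (msize_mdeg_lt lP).
  by rewrite mdegE (bigD1 i) //= leq_addr.
rewrite (bigD1_seq k) ?msupp_uniq //= big1_seq.
  by rewrite coefZ coefXn eqxx mulr1 addr0.
move=> l /andP[lk lP]; rewrite coefZ coefXn.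
case: eqVneq => [dkl|]; last by rewrite mulr0.
case/eqP: lk; apply/mnmP; apply: (digits_inj (small _ lP) (small _ kP)).
exact/esym.
Qed.


Definition power_point (F : fieldType) (m : nat) (t : F) (e : nat) : 'rV[F]_m :=
  \row_i t ^+ (e ^ i).

(** The value of [f] extends the sequence of the coordinates of the power point by
    one term: the [m + 1] numbers form a Kronecker substitution. *)
Lemma transcendental_of_values (R : realType) (m : nat)
    (f : 'rV[CC R]_m -> CC R) (t : nat -> nat -> CC R) :
  (forall e, injective (t e)) ->
  (forall e j, f (power_point m (t e j) e) = t e j ^+ (e ^ m)) ->
  transcendental f.
Proof.
move=> t_inj f_val [P P0 Pf]; case/eqP: P0; set e := msize P.
apply: (kronecker_eq0 (t_inj e) (leqnn e)) => j.
rewrite -[RHS](Pf (power_point m (t e j) e)); apply: meval_eq => i.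
case: unliftP => [k ->|->]; last by rewrite f_val.
by rewrite mxE /= /bump leqNgt ltn_ord.
Qed.

(** * Countable sets and the choice of the points *)

Lemma countable_enum (T : Type) (x0 : T) (A : set T) : countable A ->
  exists u : nat -> T, forall x, A x -> exists i, u i = x.
Proof.
move=> /countable_injP[g ginj].
have /choice[u uP] (i : nat) : exists x, forall y, A y -> g y = i -> x = y.
  have [[y [Ay gy]]|nex] := pselect (exists y, A y /\ g y = i).
    by exists y => z Az gz; apply: ginj; rewrite ?inE // gy gz.
  by exists x0 => y Ay gy; case: nex; exists y.
by exists u => x Ax; exists (g x); exact: uP.
Qed.

(** A countable set has measure zero, a nonempty open interval has not. *)
Lemma interval_avoid (R : realType) (A : set R) (a b : R) :
  countable A -> a < b -> exists s, a < s < b /\ ~ A s.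
Proof.
move=> cA ab; apply/not_existsP => h.
have sub : `]a, b[%classic `<=` A.
  move=> s; rewrite /= in_itv /= => sab; apply: contrapT => nAs.
  by apply: (h s); split.
have c : countable `]a, b[%classic.
  by apply: sub_countable cA; exact: subset_card_le.
have := countable_lebesgue_measure0 c.
rewrite lebesgue_measure_itv /= lte_fin ab -EFinD => -[] /eqP.
by rewrite subr_eq0 gt_eqF.
Qed.

(** The terms are taken in disjoint intervals, hence injectivity; their growth puts
    the points that are built on them out of the polydiscs where the corrections
    have to be small. *)
Lemma sparse_sequence (R : realType) (A : set R) : countable A ->
  exists s : nat -> R,
  [/\ injective s, forall n, 2 * n%:R < s n & forall n, ~ A (s n)].
Proof.
move=> cA; have /choice[s sP] (n : nat) :
    exists s : R, 2 * n%:R < s < 2 * n.+1%:R /\ ~ A s.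
  by apply: interval_avoid => //; rewrite ltr_pM2l // ltr_nat.
have lt n k : (n < k)%N -> s n < s k.
  move=> nk; have [/andP[_ sn] _] := sP n; have [/andP[sk _] _] := sP k.
  by rewrite (lt_trans sn) // (le_lt_trans _ sk) // ler_pM2l // ler_nat.
exists s; split => [n k nk|n|n]; last 2 first.
- by case: (sP n) => /andP[].
- by case: (sP n).
by case: (ltngtP n k) => // /lt; rewrite nk ltxx.
Qed.

Theorem theorem2 (R : realType) (m : nat) (m_gt0 : (0 < m)%N)
    (X : set 'rV[CC R]_m) (countX : countable X)
    (K : set (CC R)) (denseK : dense K)
    (E : 'rV[CC R]_m -> set (CC R))
    (denseE : forall u, X u -> dense (E u))
    (E0K : X 0 -> E 0 `&` K !=set0) :
  ~ countable [set f : 'rV[CC R]_m -> CC R |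
      [/\ entire f, transcendental f, power_series_over K f
        & forall u, X u -> E u (f u)]].
Proof.
move=> /(countable_enum (fun _ => 0))[g gP].
have [u uP] := countable_enum 0 countX.
pose i0 : 'I_m := Ordinal m_gt0.
have [|s [s_inj s_big s_notin]] :=
    @sparse_sequence R [set complex.Re (x 0 i0) | x in X].
  by apply: sub_countable countX; exact: card_image_le.
pose t N : CC R := (s N)%:C%C.
have t_inj : injective t by move=> N M [] /s_inj.
(* A step of the construction either sets the value at a point of X, or makes a
   Kronecker substitution of base e hold at its j-th point, or moves f away from
   g j; the sum type lists these tasks. *)
pose task := (nat + (nat * nat + nat))%type.
pose code N : option task := choice.unpickle N.
pose index (k : task) := choice.pickle k.
have indexK k : code (index k) = Some k by exact: choice.pickleK.
pose base N := if code N is Some (inr (inl ej)) then ej.1 else 0%N.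
pose v N := power_point m (t N) (base N).
pose y N : CC R := match code N with
  | Some (inr (inl ej)) => t N ^+ (ej.1 ^ m)
  | Some (inr (inr j)) => g j (v N) + 1
  | _ => 0 end.
(* The first coordinate of a power point is the number itself, for any base. *)
have v0 N : v N 0 i0 = t N by rewrite mxE /= expn0 expr1.
have v_inj : injective v.
  by move=> N M /(congr1 (fun x : 'rV_m => x 0 i0)); rewrite !v0 => /t_inj.
have v_notin N : ~ X (v N).
  by move=> XvN; apply: (s_notin N); exists (v N); rewrite // v0.
pose D x : set (CC R) := [set b | (X x -> E x b) /\ forall N, x = v N -> b = y N].
have DX x : X x -> D x = E x.
  move=> Xx; apply/seteqP; split => [b [Eb _]|b Eb]; first exact: Eb.
  by split => // N xv; case: (v_notin N); rewrite -xv.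
(* The origin cannot be corrected, and the enumeration u may leave X: the point
   v N is then a harmless replacement. *)
pose w N := if code N is Some (inl i)
  then if `[<X (u i) /\ u i != 0>] then u i else v N else v N.
have wE N : w N = v N \/ X (w N) /\ w N != 0.
  rewrite /w; case: (code N) => [[i|]|]; try by left.
  by case: asboolP; [right|left].
have s_gt0 N : 0 < s N by apply: le_lt_trans (s_big N); rewrite mulr_ge0.
have vi0 N : v N 0 i0 != 0 by rewrite v0 eq_complex /= eqxx andbT gt_eqF.
have w_neq0 N : w N != 0.
  by case: (wE N) => [->|[]//]; apply: contraNneq (vi0 N) => ->; rewrite mxE.
have w_reach N : reachable N (D (w N)) (w N).
  case: (wE N) => [->|[Xw _]]; last by left; rewrite DX //; exact: denseE.
  right; split.
    by exists (y N); split => [/v_notin//|M /v_inj ->].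
  exists i0; rewrite // v0 ger0_norm; last by rewrite lecR ltW.
  have -> : 2 * N%:R = (2 * N%:R : R)%:C%C :> CC R.
    by rewrite rmorphM !rmorph_nat.
  by rewrite lecR ltW.
have [c0 [Kc0 Ec0]] : exists c, K c /\ (X 0 -> E 0 c).
  have [/E0K[c [Ec Kc]]|nX0] := pselect (X 0); first by exists c.
  by have [c Kc _] := dense_approx 0 denseK ltr01; exists c.
have [f [f_entire f_K f0 fD]] := interpolation denseK Kc0 w_neq0 w_reach.
have fv N : w N = v N -> f (v N) = y N.
  by move=> wv; have := fD N; rewrite wv => -[_]; apply.
have fX x : X x -> E x (f x).
  move=> Xx; have [x0|x0] := eqVneq x 0.
    by rewrite x0 f0; apply: Ec0; rewrite -x0.
  have [i ux] := uP x Xx; have := fD (index (inl i)).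
  by rewrite /w indexK ux; case: asboolP => [_|[]//]; rewrite DX.
have f_trans : transcendental f.
  pose N e j := index (inr (inl (e, j))).
  apply: (@transcendental_of_values _ _ _ (fun e j => t (N e j))).
    by move=> e j k /t_inj /(congr1 code); rewrite !indexK => -[].
  move=> e j; have codeN : code (N e j) = Some (inr (inl (e, j))).
    exact: indexK.
  have vE : v (N e j) = power_point m (t (N e j)) e by rewrite /v /base codeN.
  by rewrite -vE fv /w ?codeN // /y codeN.
have [j gj] := gP f (And4 f_entire f_trans f_K fX).
have fN : f (v (index (inr (inr j)))) = f (v (index (inr (inr j)))) + 1.
  by rewrite {1}fv /w ?indexK // /y indexK gj.
move/eqP: fN.
by rewrite -subr_eq0 opprD addrA subrr sub0r oppr_eq0 oner_eq0.
Qed.
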